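(* Let $0<q<1$, $0<\alpha\le 1$, $n_0\in\mathbb{Z}$ and $a=q^{n_0}>0$. Let $y:T_q\to\mathbb{R}$ be a function satisfying $y(a)\ge 0$. Suppose that $$({}_{q}\nabla_{aq}^{\alpha} y)(t)\ge 0\quad\text{for each } t=q^n \text{ with } n\in\mathbb{Z},\ n<n_0.$$ Then $y$ is $c_q(\alpha)$-increasing on $\{t\in T_q: t\ge a=q^{n_0}\}$.
   Context: Let $0<q<1$ and $T_q=\{q^n:n\in\mathbb{Z}\}\cup\{0\}$. Nabla $q$-derivative: $\nabla_q f(t)=\frac{f(t)-f(qt)}{(1-q)t}$ for $t\in T_q\setminus\{0\}$. Nabla $q$-integral: for $c=q^{m}$ and $t=q^n$ with $n\le m$, $\int_c^t f(s)\nabla_q s=(1-q)\sum_{i=n}^{m-1}q^i f(q^i)$ (equal to $0$ if $n=m$). $q$-factorial function: for $\beta\in\mathbb{R}$ not a positive integer, $(t-s)_q^{\beta}=t^{\beta}\prod_{i=0}^{\infty}\frac{1-\frac{s}{t}q^{i}}{1-\frac{s}{t}q^{i+\beta}}$. $q$-Gamma function: $\Gamma_q(x)=(1-q)^{1-x}\prod_{i=0}^\infty\frac{1-q^{i+1}}{1-q^{i+x}}$ for $x>0$. $q$-fractional integral of order $\beta>0$ starting at $c\in T_q$, $c>0$: $({}_q\nabla_c^{-\beta}f)(t)=\frac{1}{\Gamma_q(\beta)}\int_c^t (t-qs)_q^{\beta-1}f(s)\nabla_q s$. (Riemann) $q$-fractional derivative of order $\alpha\in(0,1)$ starting at $c$: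 $({}_q\nabla_c^{\alpha}f)(t)=\nabla_q\big[({}_q\nabla_c^{-(1-\alpha)}f)(t)\big]$. Thus, with $c=aq=q^{n_0+1}$, $({}_q\nabla_{aq}^{\alpha}y)(t)=\nabla_q\left[\frac{1}{\Gamma_q(1-\alpha)}\int_{aq}^t(t-qs)_q^{-\alpha}y(s)\nabla_q s\right]$. For $\alpha=1$, ${}_q\nabla_c^{1}f=\nabla_q f$. Put $c_q(\alpha)=\frac{1-q^\alpha}{1-q}q^{1-\alpha}$. A function $y$ is $c_q(\alpha)$-increasing on a set $S\subseteq T_q$ if $y(q^{n-1})\ge c_q(\alpha)\,y(q^n)$ for all $q^n\in S$. *)

(* Defs.v *)
From HB Require Import structures.
From mathcomp Require Import all_boot all_order all_algebra.
From mathcomp Require Import all_classical all_reals all_analysis.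

Set Implicit Arguments.
Unset Strict Implicit.
Unset Printing Implicit Defensive.

Import Order.TTheory GRing.Theory Num.Theory.
Import numFieldNormedType.Exports.

Local Open Scope classical_set_scope.
Local Open Scope ring_scope.

(* Functions on T_q are represented by total functions R -> R; for 0 < q < 1
   the operators below, at points of T_q, only evaluate them on T_q. *)
Definition Tq (R : realType) (q : R) : set R :=
  [set t | t = 0 \/ exists n : int, t = q ^ n].

Definition nablaq (R : realType) (q : R) (f : R -> R) (t : R) : R :=
  (f t - f (q * t)) / ((1 - q) * t).

(* The integer n such that t = q ^ n: unique if 0 < q < 1 and t is a nonzero
   element of T_q; junk value 0 if t is not an integer power of q. *)
Definition qlog (R : realType) (q t : R) : int :=
  xget 0 [set n : int | t = q ^ n].

(* For c = q ^ m and t = q ^ n with n <= m, the sum runs over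
   i = n, ..., m - 1. *)
Definition qint (R : realType) (q c t : R) (f : R -> R) : R :=
  (1 - q) *
  \sum_(i \in [set i : int | qlog q t <= i < qlog q c]) q ^ i * f (q ^ i).

(* (t - s)_q^beta, for t > 0 and beta not a positive integer. *)
Definition qfact (R : realType) (q t s beta : R) : R :=
  t `^ beta *
  limn (fun N : nat => \prod_(0 <= i < N)
     ((1 - s / t * q ^+ i) / (1 - s / t * q `^ (i%:R + beta)))).

Definition qGamma (R : realType) (q x : R) : R :=
  (1 - q) `^ (1 - x) *
  limn (fun N : nat => \prod_(0 <= i < N)
     ((1 - q ^+ i.+1) / (1 - q `^ (i%:R + x)))).

Definition qfracint (R : realType) (q c beta : R) (f : R -> R) (t : R) : R :=
  (qGamma q beta)^-1 *
  qint q c t (fun s => qfact q t (q * s) (beta - 1) * f s).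

(* For 0 < alpha <= 1; at alpha = 1 the fractional integral would have order 0,
   hence the separate case. *)
Definition qfracderiv (R : realType) (q c alpha : R) (f : R -> R) : R -> R :=
  if alpha == 1 then nablaq q f else nablaq q (qfracint q c (1 - alpha) f).

Definition cq (R : realType) (q alpha : R) : R :=
  (1 - q `^ alpha) / (1 - q) * q `^ (1 - alpha).

Definition c_increasing (R : realType) (q c : R) (S : set R) (y : R -> R) :=
  forall n : int, S (q ^ n) -> c * y (q ^ n) <= y (q ^ (n - 1)).

(* Main.v *)
(* Write [g k] for the limit of [\prod_(i < N) (1 - q ^ (k + i + 1)) /
   (1 - q ^ (k + i + 1 - alpha))]; then the kernel [(t - q s)_q ^ (- alpha)] at
   [t = q ^ n], [s = q ^ (n + k)] is [t ^ (- alpha) * g k], and nonnegativity of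
   the q-derivative at [q ^ n] says that the fractional integral does not
   decrease from [q ^ (n + 1)] to [q ^ n]. Since
   [q ^ (- alpha) * g k - g (k + 1)] is the positive multiple
   [(q ^ (- alpha) - 1) / (1 - q ^ (k + 1))] of [g k], this bounds [y (q ^ n)]
   below by [c_q(alpha) * y (q ^ (n + 1))] plus a combination of the values
   [y (q ^ (n + k))], [k >= 2], with positive coefficients. Starting from
   [y a >= 0], induction gives both [y >= 0] and the claim. *)

Require Import Defs.
From HB Require Import structures.
From mathcomp Require Import all_boot all_order all_algebra.
From mathcomp Require Import all_classical all_reals all_analysis.
From mathcomp Require Import ring zify.

Import Order.TTheory GRing.Theory Num.Theory.
Import numFieldNormedType.Exports.

Local Open Scope classical_set_scope.
Local Open Scope ring_scope.

(* [r] stands for [q `^ (- alpha)]. *)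
Definition qprod (R : realType) (q r : R) (k : nat) : R^nat :=
  fun N => \prod_(0 <= i < N)
    ((1 - q ^+ (k + i).+1) / (1 - q ^+ (k + i).+1 * r)).

(** * Products behind the kernel and the resulting sum inequality *)

Section QProd.
Variables (R : realType) (q r : R).
Hypotheses (q_gt0 : 0 < q) (q_lt1 : q < 1) (r_ge1 : 1 <= r) (qr_lt1 : q * r < 1).

Let expq_gt0 m : 0 < q ^+ m. Proof. exact: exprn_gt0. Qed.

Let expqS_lt1 m : q ^+ m.+1 < 1.
Proof. by rewrite exprn_ilt1 // ltW. Qed.

Let expqr_le m : q ^+ m.+1 * r <= q ^+ m.
Proof. by rewrite exprSr -mulrA ler_piMr ?ltW. Qed.

Let expqr_lt1 m : q ^+ m.+1 * r < 1.
Proof.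
rewrite exprSr -mulrA (le_lt_trans _ qr_lt1) // ler_piMl //.
  by rewrite mulr_ge0 ?ltW // (lt_le_trans ltr01).
by rewrite exprn_ile1 ?ltW.
Qed.

Lemma qprod_gt0 k N : 0 < qprod R q r k N.
Proof. by apply: prodr_gt0 => i _; rewrite divr_gt0 ?subr_gt0. Qed.

(* Since q r < 1, each factor with m > 1 is at most (1 - q ^ m) / (1 - q ^ (m - 1)),
   and the product of these telescopes. *)
Lemma qprod_le k N :
  qprod R q r k N.+1 <= (1 - q ^+ (k + N).+1) / (1 - q ^+ k.+1 * r).
Proof.
elim: N => [|N IH]; first by rewrite /qprod big_nat1 addn0.
rewrite /qprod big_nat_recr //= -/(qprod R q r k N.+1) addnS.
set m := (k + N).+1 in IH *.
have d1 : 0 < 1 - q ^+ m by rewrite subr_gt0 expqS_lt1.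
have d2 : 0 < 1 - q ^+ m.+1 * r by rewrite subr_gt0.
have d3 : 0 < 1 - q ^+ k.+1 * r by rewrite subr_gt0.
have d4 : 0 < 1 - q ^+ m.+1 by rewrite subr_gt0.
apply: (@le_trans _ _ ((1 - q ^+ m) / (1 - q ^+ k.+1 * r) *
                       ((1 - q ^+ m.+1) / (1 - q ^+ m)))).
  apply: ler_pM => //.
  - exact/ltW/qprod_gt0.
  - by rewrite ltW // divr_gt0.
  - by rewrite ler_pM2l // lef_pV2 // lerD2l lerN2.
rewrite le_eqVlt; apply/orP; left; apply/eqP; field; by rewrite !gt_eqF.
Qed.

Lemma qprod_nondecreasing k : nondecreasing_seq (qprod R q r k).
Proof.
apply/nondecreasing_seqP => N.
rewrite [leRHS]/qprod big_nat_recr //= ler_peMr ?(ltW (qprod_gt0 _ _)) //.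
by rewrite ler_pdivlMr ?subr_gt0 // mul1r lerD2l lerN2 ler_peMr // ltW.
Qed.

(** Monotone convergence: the numerator in [qprod_le] is at most 1, which leaves a bound independent
    of [N]. *)
Lemma qprod_cvg k : cvgn (qprod R q r k).
Proof.
apply: nondecreasing_is_cvgn; first exact: qprod_nondecreasing.
exists (1 - q ^+ k.+1 * r)^-1 => _ [N _ <-].
apply: le_trans (qprod_nondecreasing k _ _ (leqnSn N)) _.
apply: le_trans (qprod_le k N) _.
by rewrite ler_piMl ?gerBl ?(ltW (expq_gt0 _)) // invr_ge0 subr_ge0 ltW.
Qed.

(** Each factor is at least 1 because [1 <= r], so the limit dominates the empty product. *)
Lemma lim_qprod_gt0 k : 0 < limn (qprod R q r k).
Proof.
apply: (lt_le_trans (qprod_gt0 k 0)).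
by apply: nondecreasing_cvgn_le; [exact: qprod_nondecreasing|exact: qprod_cvg].
Qed.

Lemma lim_qprodS k : limn (qprod R q r k) =
  (1 - q ^+ k.+1) / (1 - q ^+ k.+1 * r) * limn (qprod R q r k.+1).
Proof.
apply: cvg_lim => //; rewrite -cvg_shiftS.
rewrite (_ : (fun N => qprod R q r k N.+1) = fun N =>
  (1 - q ^+ k.+1) / (1 - q ^+ k.+1 * r) * qprod R q r k.+1 N).
  by apply: cvgMl_tmp; exact: qprod_cvg.
apply/funext => N; rewrite /qprod big_nat_recl //= addn0; congr (_ * _).
by apply: eq_bigr => i _; rewrite addnS.
Qed.

(* The sum hypothesis compares the fractional integrals at [q ^ (n + 1)] and
   [q ^ n], with [Y k = y (q ^ (n + k))] and a common positive factor removed. *)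
Lemma qprod_sum_le (Y : nat -> R) (p : nat) :
  (forall k, (k < p)%N -> 0 <= Y k.+2) ->
  r * (\sum_(0 <= k < p.+1) q ^+ k.+1 * (limn (qprod R q r k) * Y k.+1)) <=
    \sum_(0 <= k < p.+2) q ^+ k * (limn (qprod R q r k) * Y k) ->
  q * (r - 1) / (1 - q) * Y 1%N <= Y 0%N.
Proof.
move=> Y0; set g := fun k => limn (qprod R q r k).
have gE k : r * g k - g k.+1 = (r - 1) / (1 - q ^+ k.+1) * g k.
  rewrite {1 3}/g lim_qprodS -/(g k.+1); field.
  by rewrite !subr_eq0 !gt_eqF.
rewrite [leRHS]big_nat_recl //= mulr_sumr -lerBlDr -sumrB.
rewrite big_nat_recl //= expr0 expr1 mul1r -/(g 0%N) -/(g 1%N) => H.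
(* Pairing equal powers of [q] in the two sums gives [Y i.+2] a coefficient that is nonnegative by
   [gE]. *)
have tail : 0 <= \sum_(0 <= i < p)
    (r * (q ^+ i.+2 * (g i.+1 * Y i.+2)) - q ^+ i.+2 * (g i.+2 * Y i.+2)).
  rewrite big_nat_cond; apply: sumr_ge0 => i /andP[/andP[_ ip] _].
  rewrite (_ : _ - _ = q ^+ i.+2 * ((r * g i.+1 - g i.+2) * Y i.+2)); last by ring.
  rewrite gE mulr_ge0 ?(ltW (expq_gt0 _)) // mulr_ge0 ?Y0 // mulr_ge0 //.
    by rewrite divr_ge0 ?subr_ge0 // ltW.
  exact/ltW/lim_qprod_gt0.
rewrite -(ler_pM2l (lim_qprod_gt0 0)) -/(g 0%N); apply: le_trans H.
rewrite -[leLHS]addr0 lerD //.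
rewrite [leRHS](_ : _ = q * (r * g 0%N - g 1%N) * Y 1%N); last by ring.
by rewrite gE expr1 le_eqVlt; apply/orP; left; apply/eqP; ring.
Qed.

End QProd.

(** * The q-operators at integer powers of [q] *)

Section QCalculus.
Variables (R : realType) (q : R).
Hypotheses (q_gt0 : 0 < q) (q_lt1 : q < 1).

Let q_neq0 : q != 0. Proof. by rewrite gt_eqF. Qed.

Lemma qlogK (n : int) : qlog q (q ^ n) = n.
Proof.
(* The set contains [n], so the default 0 of [xget] never shows; injectivity of the powers of [q]
   does the rest. *)
have := @xgetPex _ (0 : int) [set m : int | q ^ n = q ^ m] (ex_intro _ n erefl).
by move=> /= /(ieexprIz q_gt0 (negbT (lt_eqF q_lt1))).
Qed.

Lemma qintE (n : int) (p : nat) (f : R -> R) :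
  qint q (q ^ (n + p%:Z)) (q ^ n) f =
  (1 - q) * \sum_(0 <= k < p) q ^ (n + k%:Z) * f (q ^ (n + k%:Z)).
Proof.
rewrite /qint !qlogK; congr (_ * _).
pose ns := [seq n + k%:Z | k <- index_iota 0 p].
have uniq_ns : uniq ns by rewrite map_inj_uniq ?iota_uniq // => i j /addrI [].
transitivity (\sum_(i <- ns) q ^ i * f (q ^ i)); last by rewrite big_map.
rewrite [RHS]fsbig_seq //.
apply: eq_fsbigl; apply/seteqP; split=> i /=.
  move=> /andP[ni inp]; apply/mapP; exists `|i - n|%N; last by lia.
  by rewrite mem_index_iota; lia.
by case/mapP=> k; rewrite mem_index_iota => kp ->; lia.
Qed.

(** With [t = q ^ n] and [s = q ^ (n + k)], the ratio [q * s / t] is [q ^+ k.+1], and the exponent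
    [i - alpha] contributes [q ^+ i * r]. *)
Lemma qfactE (alpha : R) (n : int) (k : nat) :
  qfact q (q ^ n) (q * q ^ (n + k%:Z)) (1 - alpha - 1) =
  (q ^ n) `^ (- alpha) * limn (qprod R q (q `^ (- alpha)) k).
Proof.
rewrite /qfact (_ : 1 - alpha - 1 = - alpha); last by ring.
congr (_ * _); apply: (congr1 (fun u : R^nat => limn u)).
apply/funext => N; apply: eq_bigr => i _.
rewrite powRD ?q_neq0 ?implybT // powR_mulrn ?ltW // expfzDr //.
have qn : q ^ n != 0 by rewrite expfz_neq0.
rewrite (_ : q * _ / _ = q ^+ k.+1); last by rewrite exprS -exprnP; field.
by rewrite mulrA -!exprD addSn.
Qed.

(** Reduces positivity of the q-Gamma value to [lim_qprod_gt0]. *)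
Lemma qGammaE (alpha : R) :
  qGamma q (1 - alpha) =
  (1 - q) `^ alpha * limn (qprod R q (q `^ (- alpha)) 0).
Proof.
rewrite /qGamma (_ : 1 - (1 - alpha) = alpha); last by ring.
congr (_ * _); apply: (congr1 (fun u : R^nat => limn u)).
apply/funext => N; apply: eq_bigr => i _.
rewrite add0n addrA natr1 powRD ?q_neq0 ?implybT //.
by rewrite powR_mulrn ?ltW.
Qed.

Lemma qfracintE (alpha : R) (n : int) (p : nat) (y : R -> R) :
  qfracint q (q ^ (n + p%:Z)) (1 - alpha) y (q ^ n) =
  (qGamma q (1 - alpha))^-1 * (1 - q) * q ^ n * (q ^ n) `^ (- alpha) *
  \sum_(0 <= k < p) q ^+ k *
     (limn (qprod R q (q `^ (- alpha)) k) * y (q ^ (n + k%:Z))).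
Proof.
rewrite /qfracint qintE -!mulrA; congr (_ * (_ * _)).
rewrite !mulr_sumr; apply: eq_bigr => k _.
rewrite qfactE expfzDr // -exprnP; ring.
Qed.

Lemma nablaq_ge0 (f : R -> R) (t : R) : 0 < t ->
  (0 <= nablaq q f t) = (f (q * t) <= f t).
Proof.
by move=> t0; rewrite /nablaq pmulr_lge0 ?subr_ge0 // invr_gt0 mulr_gt0 // subr_gt0.
Qed.

(** This is the constant as it comes out of [qprod_sum_le]. *)
Lemma cqE (alpha : R) : cq q alpha = q * (q `^ (- alpha) - 1) / (1 - q).
Proof.
rewrite /cq powRD ?q_neq0 ?implybT // powRr1 ?ltW // powRN.
have : q `^ alpha != 0 by rewrite gt_eqF // powR_gt0.
by move=> h; field; rewrite h subr_eq0 gt_eqF.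
Qed.

Lemma qfracderiv_step (alpha : R) (n : int) (p : nat) (y : R -> R) :
  0 < alpha <= 1 ->
  (forall k, (k < p)%N -> 0 <= y (q ^ (n + k.+2%:Z))) ->
  0 <= qfracderiv q (q ^ (n + p.+2%:Z)) alpha y (q ^ n) ->
  cq q alpha * y (q ^ (n + 1)) <= y (q ^ n).
Proof.
move=> /andP[a0 a1] y0; rewrite /qfracderiv.
have qn0 : 0 < q ^ n by rewrite exprz_gt0.
have qS : q * q ^ n = q ^ (n + 1) by rewrite expfzDr // expr1z mulrC.
(* For [alpha = 1] the derivative is the plain [nablaq] and the constant is 1. *)
case: eqP => [->|/eqP a_neq1].
  rewrite nablaq_ge0 // qS; congr (_ <= _).
  rewrite /cq powRr1 ?ltW // subrr powRr0 mulr1 divff ?mul1r //.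
  by rewrite subr_eq0 gt_eqF.
have {a_neq1}a1 : alpha < 1 by rewrite lt_neqAle a_neq1.
set r := q `^ (- alpha).
have r_ge1 : 1 <= r.
  rewrite /r powRN invf_ge1 ?powR_gt0 // -(powRr0 q).
  by rewrite ger_powR ?q_gt0 ?ltW.
(* Here [q * r] is [q] to the power [1 - alpha], which is positive as [alpha < 1]. *)
have qr_lt1 : q * r < 1.
  rewrite -{1}(powRr1 (ltW q_gt0)) -powRD ?q_neq0 ?implybT //.
  rewrite [ltRHS](_ : _ = 1 `^ (1 - alpha)); last by rewrite powR1.
  by rewrite gt0_ltr_powR ?nnegrE ?subr_gt0 // ltW.
have gamma_gt0 : 0 < qGamma q (1 - alpha).
  by rewrite qGammaE mulr_gt0 ?powR_gt0 ?subr_gt0 // lim_qprod_gt0.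
rewrite nablaq_ge0 // qS (_ : n + p.+2%:Z = n + 1 + p.+1%:Z); last by lia.
rewrite qfracintE (_ : n + 1 + p.+1%:Z = n + p.+2%:Z); last by lia.
rewrite qfracintE -/r -qS powRM ?(ltW q_gt0) ?(ltW qn0) // -/r qS.
set C := (X in _ <= X * _).
have C0 : 0 < C by rewrite !mulr_gt0 ?invr_gt0 ?powR_gt0 ?subr_gt0.
set S1 := (X in _ * X <= _).
(* Passing from [t = q ^ n] to [q * t] multiplies [t * t ^ (- alpha)] by [q * r]; the factor [q]
   then turns each [q ^+ k] into [q ^+ k.+1]. *)
rewrite (_ : _ * S1 = C * (r * (q * S1))); last by rewrite /C -qS; ring.
rewrite ler_pM2l // {}/S1 => H.
have := @qprod_sum_le R q r q_gt0 q_lt1 r_ge1 qr_lt1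
  (fun k => y (q ^ (n + k%:Z))) p y0.
rewrite cqE -/r addr0; apply; apply: le_trans H.
rewrite [q * _]mulr_sumr le_eqVlt; apply/orP; left; apply/eqP; congr (_ * _).
apply: eq_bigr => k _; rewrite exprS -!mulrA.
by rewrite (_ : n + 1 + k%:Z = n + k.+1%:Z)//; lia.
Qed.

End QCalculus.

Theorem theorem2p1 (R : realType) (q alpha : R) (n0 : int) (y : R -> R)
    (hq0 : 0 < q) (hq1 : q < 1) (halpha0 : 0 < alpha) (halpha1 : alpha <= 1)
    (hya : 0 <= y (q ^ n0))
    (hy : forall n : int, n < n0 ->
      0 <= qfracderiv q (q ^ n0 * q) alpha y (q ^ n)) :
  c_increasing q (cq q alpha) [set t | Tq q t /\ q ^ n0 <= t] y.
Proof.
(* With [n = n0 - p.+1], the starting point [a q] is [q ^ (n + p.+2)]. *)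
have step (p : nat) : (forall k, (k <= p)%N -> 0 <= y (q ^ (n0 - k%:Z))) ->
    cq q alpha * y (q ^ (n0 - p%:Z)) <= y (q ^ (n0 - p.+1%:Z)).
  move=> y0; have lt_n0 : n0 - p.+1%:Z < n0 by lia.
  rewrite (_ : n0 - p%:Z = n0 - p.+1%:Z + 1); last by lia.
  apply: (@qfracderiv_step _ _ hq0 hq1 _ _ p); first by rewrite halpha0.
    move=> k kp; rewrite (_ : _ + _ = n0 - (p - k.+1)%N%:Z); last by lia.
    by apply: y0; lia.
  rewrite (_ : n0 - p.+1%:Z + p.+2%:Z = n0 + 1); last by lia.
  by rewrite expfzDr ?gt_eqF // expr1z; exact: hy.
have cq0 : 0 <= cq q alpha.
  rewrite /cq mulr_ge0 ?powR_ge0 // divr_ge0 ?subr_ge0 ?(ltW hq1) //.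
  by rewrite -(powRr0 q) ger_powR ?hq0 ?ltW.
(* The induction carries all [k <= p], since [step] uses every earlier value. *)
have y_ge0 (p : nat) : forall k, (k <= p)%N -> 0 <= y (q ^ (n0 - k%:Z)).
  elim: p => [|p IH] k; first by rewrite leqn0 => /eqP ->; rewrite subr0.
  rewrite leq_eqVlt => /orP[/eqP ->|]; last exact: IH.
  by apply: le_trans (step p IH); rewrite mulr_ge0 // IH.
move=> n [_ /=].
(* Powers are rewritten in base [q^-1 > 1], where they increase with the exponent, to get
   [n <= n0]. *)
rewrite -{1}(opprK n0) -{1}(opprK n) -!(exprz_inv q) ler_eXz2l ?invf_gt1 // lerN2.
move=> n_le.
rewrite (_ : n = n0 - `|n0 - n|%N%:Z); last by lia.
rewrite (_ : _ - 1 = n0 - `|n0 - n|%N.+1%:Z); last by lia.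
exact/step/y_ge0.
Qed.
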